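(* Let $\Gamma\subseteq\mathbb{R}^d$ be a $d$-dimensional lattice, and let $f^{iso}(m)$ denote the number of coincidence isometries of $\Gamma$ of coincidence index $m$ divided by the order of the point group of $\Gamma$. Then $f^{iso}$ is supermultiplicative, i.e. $f^{iso}(mn)\ge f^{iso}(m)f^{iso}(n)$ for all coprime positive integers $m$ and $n$.
   Context: Let $\Gamma\subseteq\mathbb{R}^d$ be a lattice of full rank $d$. A linear isometry $R\in\mathrm{O}(d)$ is a coincidence isometry of $\Gamma$ if $\Gamma(R):=\Gamma\cap R\Gamma$ has finite index in $\Gamma$. The coincidence isometries form a group $OC(\Gamma)$. The coincidence index is $\Sigma(R):=[\Gamma:\Gamma(R)]$. The point group is the finite group $\mathcal{P}=\{R\in \mathrm{O}(d): R\Gamma=\Gamma\}$. For $m\in\mathbb{N}=\{1,2,\dots\}$, $f^{iso}(m)$ is defined by requiring that $|\mathcal{P}|\,f^{iso}(m)$ is the number of $R\in OC(\Gamma)$ with $\Sigma(R)=m$; equivalently, $f^{iso}(m)$ is the number of cosets $R\mathcal{P}$ of coincidence isometries $R$ of index $m$. *)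

(* Defs.v *)
From HB Require Import structures.
From mathcomp Require Import all_boot all_order all_algebra finmap.
From mathcomp Require Import boolp classical_sets functions cardinality.
From mathcomp Require Import reals.

Set Implicit Arguments.
Unset Strict Implicit.
Unset Printing Implicit Defensive.

Import Order.TTheory GRing.Theory Num.Theory.

Local Open Scope classical_set_scope.
Local Open Scope ring_scope.

(* Cardinality of a finite set, as a natural number. The value on infinite
   sets is a junk value (0). *)
Definition card_set (T : choiceType) (S : set T) : nat := #|` fset_set S|.

Definition cosets (V : zmodType) (G H : set V) : set (set V) :=
  [set [set x + h | h in H] | x in G].

Definition finite_index (V : zmodType) (G H : set V) : Prop :=
  finite_set (cosets G H).

Definition index_of (V : zmodType) (G H : set V) : nat :=
  card_set (cosets G H).

(* Vectors of R^d are column vectors; the columns of B form a Z-basis of L. *)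
Definition is_lattice (R : realType) (d : nat) (L : set 'cV[R]_d) : Prop :=
  exists2 B : 'M[R]_d, B \in unitmx &
    L = [set B *m map_mx intr z | z in [set: 'cV[int]_d]].

(* Membership in O(d), a matrix A acting on column vectors by x |-> A *m x. *)
Definition is_isometry (R : realType) (d : nat) (A : 'M[R]_d) : Prop :=
  A^T *m A = 1%:M.

Definition image_lattice (R : realType) (d : nat)
    (A : 'M[R]_d) (L : set 'cV[R]_d) : set 'cV[R]_d :=
  [set A *m x | x in L].

Definition coincidence_lattice (R : realType) (d : nat)
    (L : set 'cV[R]_d) (A : 'M[R]_d) : set 'cV[R]_d :=
  L `&` image_lattice A L.

Definition coincidence_isometries (R : realType) (d : nat)
    (L : set 'cV[R]_d) : set 'M[R]_d :=
  [set A | is_isometry A /\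
           finite_index L (coincidence_lattice L A)].

Definition coincidence_index (R : realType) (d : nat)
    (L : set 'cV[R]_d) (A : 'M[R]_d) : nat :=
  index_of L (coincidence_lattice L A).

Definition point_group (R : realType) (d : nat)
    (L : set 'cV[R]_d) : set 'M[R]_d :=
  [set A | is_isometry A /\ image_lattice A L = L].

(* When L is a lattice and m > 0, both counted sets are finite. The quotient
   is formed in rat, so no integrality is presupposed. *)
Definition fiso (R : realType) (d : nat) (L : set 'cV[R]_d) (m : nat) : rat :=
  (card_set [set A | coincidence_isometries L A /\
                     coincidence_index L A = m])%:R
  / (card_set (point_group L))%:R.

(* Main.v *)
(** For coincidence isometries R and S, the index of RS divides the product of
    the indices; volume preservation gives R^-1 = R^T the same index as R, so
    for coprime indices m and n, RS has index exactly mn.  If RS = R'S', then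
    T = R^-1 R' = S S'^-1 has an index dividing both m^2 and n^2, hence T has
    index 1 and lies in the point group P.  So the fibres of (R, S) |-> RS have
    at most |P| elements. *)

Require Import Defs.
From mathcomp Require Import all_boot all_order all_algebra finmap.
From mathcomp Require Import boolp classical_sets functions cardinality reals.

Set Implicit Arguments.
Unset Strict Implicit.
Unset Printing Implicit Defensive.

Import Order.TTheory GRing.Theory Num.Theory.
Local Open Scope classical_set_scope.
Local Open Scope ring_scope.

(** * Subgroups of abelian groups and their indices *)

Definition is_subgroup (V : zmodType) (H : set V) : Prop :=
  H 0 /\ forall x y, H x -> H y -> H (x - y).

Lemma is_subgroupN (V : zmodType) (H : set V) x :
  is_subgroup H -> H x -> H (- x).
Proof. by move=> [H0 HB] /(HB _ _ H0); rewrite sub0r. Qed.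

Lemma is_subgroupD (V : zmodType) (H : set V) x y :
  is_subgroup H -> H x -> H y -> H (x + y).
Proof.
move=> sH Hx /(is_subgroupN sH) Hy; rewrite -[y]opprK; exact: sH.2.
Qed.

Lemma is_subgroupI (V : zmodType) (G H : set V) :
  is_subgroup G -> is_subgroup H -> is_subgroup (G `&` H).
Proof.
move=> sG sH; split=> [|x y [Gx Hx] [Gy Hy]]; first by split; [exact: sG.1|exact: sH.1].
by split; [exact: sG.2|exact: sH.2].
Qed.

(* [f] induces a bijection from G / (G :&: H) onto [T]; its values off G are
   irrelevant. *)
Definition has_index (V : zmodType) (G H : set V) (n : nat) : Prop :=
  exists (T : finType) (f : V -> T),
    [/\ #|T| = n, forall t, exists2 x, G x & f x = t
      & forall x y, G x -> G y -> (f x = f y <-> H (x - y))].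

Lemma has_index_section (V : zmodType) (G : set V) (T : Type) (f : V -> T) :
  (forall t, exists2 x, G x & f x = t) ->
  exists g : T -> V, forall t, G (g t) /\ f (g t) = t.
Proof.
move=> fs; have [t|g gP] := @boolp.choice _ _ (fun t x => G x /\ f x = t).
  by have [x] := fs t; exists x.
by exists g.
Qed.

Lemma has_index_uniq (V : zmodType) (G H : set V) m n :
  has_index G H m -> has_index G H n -> m = n.
Proof.
have le k l : has_index G H k -> has_index G H l -> (k <= l)%N.
  move=> [T [f [<- fs fk]]] [U [e [<- es ek]]].
  have [g gP] := has_index_section fs.
  apply: (@leq_card _ _ (e \o g)) => t u /= /(ek _ _ (gP t).1 (gP u).1).
  by move=> /(fk _ _ (gP t).1 (gP u).1); rewrite !(gP _).2.
by move=> Hm Hn; apply/eqP; rewrite eqn_leq !le.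
Qed.

Lemma has_index_gt0 (V : zmodType) (G H : set V) n :
  is_subgroup G -> has_index G H n -> (0 < n)%N.
Proof. by move=> sG [T [f [<- _ _]]]; apply/card_gt0P; exists (f 0). Qed.

(** With [g] choosing a representative in each class modulo [H], the class of x modulo [K] is
    recorded by its class modulo [H] together with the class modulo [K] of its deviation x - g (f
    x), which lies in [H]. *)
Lemma has_index_mul (V : zmodType) (G H K : set V) m n :
  is_subgroup G -> H `<=` G -> is_subgroup H -> K `<=` H ->
  has_index G H m -> has_index H K n -> has_index G K (m * n).
Proof.
move=> sG HG sH KH [T [f [<- fs fk]]] [U [e [<- es ek]]].
have [g gP] := has_index_section fs.
exists (T * U)%type, (fun x => (f x, e (x - g (f x)))).
have HB x : G x -> H (x - g (f x)).
  by move=> Gx; apply/fk => //; [exact: (gP _).1|rewrite (gP _).2].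
split; first by rewrite card_prod.
- move=> [t u]; have [y Hy <-] := es u.
  have Gyt : G (y + g t) by apply: is_subgroupD => //; [exact: HG|exact: (gP t).1].
  have fyt : f (y + g t) = t.
    rewrite -[RHS](gP t).2; apply/fk => //; first exact: (gP t).1.
    by rewrite addrK.
  by exists (y + g t); rewrite // fyt addrK.
- move=> x y Gx Gy; split.
    move=> [fxy]; rewrite fxy => /ek; rewrite -{1}fxy.
    by move=> /(_ (HB _ Gx) (HB _ Gy)); rewrite opprB addrA subrK.
  move=> Kxy; have fxy : f x = f y by apply/fk => //; exact: KH.
  rewrite fxy; congr pair; apply/ek; [by rewrite -fxy; exact: HB|exact: HB|].
  by rewrite opprB addrA subrK.
Qed.

Lemma has_index_of_finite (V : zmodType) (G H : set V) (T : finType) (f : V -> T) :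
  is_subgroup G -> is_subgroup H ->
  (forall x y, G x -> G y -> f x = f y -> H (x - y)) -> exists n, has_index G H n.
Proof.
move=> sG sH fH.
(* The class of x is encoded by the set of f-values it meets. *)
pose c x : {set T} := finset (fun t => `[< exists y, [/\ G y, f y = t & H (x - y)] >]).
pose S : pred {set T} := fun s => `[< exists2 x, G x & c x = s >].
have cS x : G x -> S (c x) by move=> Gx; apply/asboolP; exists x.
have cE x y : G x -> G y -> (c x = c y <-> H (x - y)).
  move=> Gx Gy; split=> [cxy|Hxy].
    have : f x \in c x.
      by rewrite inE; apply/asboolP; exists x; rewrite subrr; split=> //; exact: sH.1.
    rewrite cxy inE => /asboolP[z [Gz fzx Hyz]].
    have Hxz := fH _ _ Gx Gz (esym fzx).
    by have := sH.2 _ _ Hxz Hyz; rewrite opprB addrA subrK.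
  apply/setP => t; rewrite !inE; apply/asboolP/asboolP => -[z [Gz fz Hz]]; exists z; split=> //.
    by have := sH.2 _ _ Hz Hxy; rewrite opprB addrC addrA subrK.
  by have := is_subgroupD sH Hxy Hz; rewrite addrA subrK.
(* The default, the class of 0, can be taken only for x outside [G]. *)
pose e x : {s | S s} := insubd (Sub (c 0) (cS 0 sG.1)) (c x).
have eE x : G x -> val (e x) = c x by move=> Gx; rewrite insubdK //; exact: (cS _ Gx).
exists #|{: {s | S s}}|, {s | S s}, e; split=> //.
  move=> [s Ss]; have /asboolP[x Gx cx] := Ss.
  by exists x => //; apply: val_inj; rewrite eE.
move=> x y Gx Gy; rewrite -cE // -!eE //.
by split=> [->//|/val_inj].
Qed.

(** A class map for G / K separates classes modulo the larger [H], and its restriction to [H]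
    separates classes modulo [K]; so both intermediate indices exist, and uniqueness of the index
    gives their product. *)
Lemma has_index_tower (V : zmodType) (G H K : set V) n :
  is_subgroup G -> is_subgroup H -> is_subgroup K -> K `<=` H -> H `<=` G ->
  has_index G K n ->
  exists a b, [/\ has_index G H a, has_index H K b & (a * b)%N = n].
Proof.
move=> sG sH sK KH HG Gn; have [T [f [Tn fs fk]]] := Gn.
have [a Ha] : exists a, has_index G H a.
  by apply: (has_index_of_finite (f := f)) => // x y Gx Gy /fk; move=> /(_ Gx Gy) /KH.
have [b Hb] : exists b, has_index H K b.
  apply: (has_index_of_finite (f := f)) => // x y Hx Hy /fk; apply; exact: HG.
exists a, b; split=> //.
exact: has_index_uniq (has_index_mul sG HG sH KH Ha Hb) Gn.
Qed.

(** By the second isomorphism theorem, H / (H ∩ K) is (H + K) / K, and [H + K : K] divides [G : K]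
    in the tower K ⊆ H + K ⊆ G. *)
Lemma has_index_dvd_setI (V : zmodType) (G H K : set V) n :
  is_subgroup G -> is_subgroup H -> is_subgroup K -> K `<=` G -> H `<=` G ->
  has_index G K n -> exists2 m, (m %| n)%N & has_index H (H `&` K) m.
Proof.
move=> sG sH sK KG HG Gn.
pose S := [set x | exists h k, [/\ H h, K k & x = h + k]].
have sS : is_subgroup S.
  split; first by exists 0, 0; rewrite addr0; split=> //; [exact: sH.1|exact: sK.1].
  move=> _ _ [h [k [Hh Kk ->]]] [h' [k' [Hh' Kk' ->]]].
  exists (h - h'), (k - k'); rewrite opprD addrACA.
  by split=> //; [exact: sH.2|exact: sK.2].
have HS : H `<=` S by move=> x Hx; exists x, 0; rewrite addr0; split=> //; exact: sK.1.
have KS : K `<=` S by move=> x Kx; exists 0, x; rewrite add0r; split=> //; exact: sH.1.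
have SG : S `<=` G.
  by move=> _ [h [k [/HG Gh /KG Gk ->]]]; exact: is_subgroupD.
have [a [b [_ [T [f [Tb fs fk]]] <-]]] := has_index_tower sG sS sK KS SG Gn.
exists b; first exact: dvdn_mull.
exists T, f; split=> // [t|x y Hx Hy].
  have [_ [h [k [Hh Kk ->]]] <-] := fs t; exists h => //.
  apply/fk; [exact: HS|by apply: is_subgroupD => //; [exact: HS|exact: KS]|].
  by rewrite opprD addrA subrr sub0r; exact: is_subgroupN.
rewrite fk; [|exact: HS|exact: HS]; split=> [Kxy|[]//].
by split=> //; exact: sH.2.
Qed.

Lemma has_index_Lagrange (V : zmodType) (G H : set V) n x :
  is_subgroup G -> is_subgroup H -> H `<=` G -> has_index G H n -> G x -> H (x *+ n).
Proof.
move=> sG sH HG [T [f [<- fs fk]]] Gx.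
(* Translation by x permutes the cosets, so summing over a transversal changes
   the sum by x *+ #|G / H| modulo H. *)
have [g gP] := has_index_section fs.
have Gg t := (gP t).1; have fg t := (gP t).2.
pose s t := f (g t + x).
have Ggx t : G (g t + x) by exact: is_subgroupD.
have s_inj : injective s.
  move=> t u /fk-/(_ (Ggx _) (Ggx _)); rewrite opprD addrACA subrr addr0.
  by move/fk => /(_ (Gg _) (Gg _)); rewrite !fg.
have sumH : H (\sum_t (g t + x - g (s t))).
  apply: (big_ind H) => [||t _]; [exact: sH.1|by move=> ? ?; exact: is_subgroupD|].
  by apply/fk => //; rewrite fg.
move: sumH; rewrite sumrB big_split /= sumr_const.
have -> : \sum_t g (s t) = \sum_t g t by rewrite [RHS](reindex_inj s_inj).
by rewrite addrAC subrr add0r.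
Qed.

Lemma has_index_inj (U V : zmodType) (phi : {additive U -> V}) (G H : set U) n :
  injective phi -> has_index G H n -> has_index (phi @` G) (phi @` H) n.
Proof.
move=> phi_inj [T [f [<- fs fk]]].
(* A left inverse of [phi]; its default 0 off the range of [phi] never matters, as classes are
   compared only inside the image of [G]. *)
pose psi v := xget 0 [set u | phi u = v].
have phiK u : psi (phi u) = u.
  by apply: phi_inj; exact: (@xgetPex _ 0 [set w | phi w = phi u] (ex_intro _ u erefl)).
exists T, (f \o psi); split=> // [t|_ _ [x Gx <-] [y Gy <-]].
  by have [x Gx <-] := fs t; exists (phi x); [exists x|rewrite /= phiK].
rewrite /= !phiK fk // -raddfB; split=> [Hxy|[z Hz /phi_inj <-//]].
by exists (x - y).
Qed.

Lemma cosets_eq (V : zmodType) (H : set V) x y : is_subgroup H ->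
  [set x + h | h in H] = [set y + h | h in H] <-> H (x - y).
Proof.
move=> sH; split=> [E|Hxy].
  have : [set x + h | h in H] x by exists 0; [exact: sH.1|rewrite addr0].
  by rewrite E => -[h Hh <-]; rewrite addrAC subrr add0r.
have sub u v : H (u - v) -> [set u + h | h in H] `<=` [set v + h | h in H].
  move=> Huv _ [h Hh <-]; exists (u - v + h); first exact: is_subgroupD.
  by rewrite addrA addrCA subrr addr0.
by apply/seteqP; split; apply: sub => //; rewrite -opprB; exact: is_subgroupN.
Qed.

(** The bridge to the definitions used in the theorem. Finiteness appears as a separate conjunct
    because [index_of] takes the junk value 0 on an infinite set of cosets. *)
Lemma has_indexP (V : zmodType) (G H : set V) n :
  is_subgroup G -> is_subgroup H ->
  has_index G H n <-> finite_index G H /\ index_of G H = n.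
Proof.
move=> sG sH; split=> [[T [f [<- fs fk]]]|[finC <-]].
  have [g gP] := has_index_section fs.
  have Gg t := (gP t).1; have fg t := (gP t).2.
  pose C (i : 'I_#|T|) := [set g (enum_val i) + h | h in H].
  have CE : cosets G H = C @` [set: 'I_#|T|].
    apply/seteqP; split=> [_ [x Gx <-]|_ [t _ <-]]; last by exists (g (enum_val t)).
    exists (enum_rank (f x)) => //.
    by apply/cosets_eq => //; apply/fk; rewrite ?enum_rankK.
  have C_inj : injective C by move=> t u /(cosets_eq _ _ sH)/(fk _ _ (Gg _) (Gg _)); rewrite !fg; exact: enum_val_inj.
  split; first by rewrite /finite_index CE; exact/finite_image/finite_finset.
  apply: card_fset_set; rewrite CE.
  apply: card_eq_trans (inj_card_eq (in2W C_inj)) _.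
  by rewrite card_eq_sym; exact: card_II.
have C0 : [set 0 + h | h in H] \in fset_set (cosets G H).
  by rewrite in_fset_set // inE; exists 0 => //; exact: sG.1.
pose f x : fset_set (cosets G H) := insubd [` C0]%fset [set x + h | h in H].
have fE x : G x -> val (f x) = [set x + h | h in H].
  by move=> Gx; rewrite insubdK // in_fset_set // inE; exists x.
exists (fset_set (cosets G H)), f; split.
- by rewrite -cardfE.
- move=> [s Ss]; have := Ss; rewrite in_fset_set // inE => -[x Gx cx].
  by exists x => //; apply: val_inj; rewrite fE.
- move=> x y Gx Gy; rewrite -cosets_eq // -!fE //.
  by split=> [->//|/val_inj].
Qed.

Lemma is_subgroup_image (U V : zmodType) (phi : {additive U -> V}) (G : set U) :
  is_subgroup G -> is_subgroup (phi @` G).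
Proof.
move=> sG; split; first by exists 0; [exact: sG.1|exact: raddf0].
move=> _ _ [x Gx <-] [y Gy <-]; exists (x - y); last exact: raddfB.
exact: sG.2.
Qed.

Lemma is_subgroupT (V : zmodType) : is_subgroup [set: V].
Proof. by []. Qed.

(** * Index of the image of an integer matrix *)

Lemma diag_mx_index (d : nat) (e : 'rV[int]_d) :
  (forall i, e 0 i != 0) ->
  has_index [set: 'cV[int]_d] (mulmx (diag_mx e) @` setT) `|\prod_i e 0 i|.
Proof.
move=> e0; have e_gt0 i : (0 < `|e ord0 i|)%N by rewrite absz_gt0.
have lt_mod (z : 'cV[int]_d) i : (`|(z i ord0 %% e ord0 i)%Z| < `|e ord0 i|)%N.
  by rewrite -ltz_nat gez0_abs ?modz_ge0 // abszE ltz_mod.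
(* The quotient is the product of the groups Z / e_i, so a class is a tuple of residues. Residues
   are nonnegative even when e_i is negative, so [absz] only moves them to [nat]. *)
pose f z : {dffun forall i : 'I_d, 'I_(`|e ord0 i|)} :=
  [ffun i => Ordinal (lt_mod z i)].
exists {dffun forall i : 'I_d, 'I_(`|e ord0 i|)}, f; split.
- rewrite card_dep_ffun foldrE big_map (big_morph absz abszM (erefl (absz 1))).
  rewrite big_enum /=; apply: eq_bigr => i _; exact: card_ord.
- move=> t; exists (\col_i (t i : nat)%:Z) => //.
  apply/ffunP => i; rewrite ffunE; apply: val_inj => /=.
  rewrite mxE -modz_abs modz_small //=.
  exact: ltn_ord.
- move=> x y _ _; split=> [fxy|[z _ /matrixP xy]].
    exists (\col_i ((x i ord0 - y i ord0) %/ e ord0 i)%Z) => //.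
    apply/matrixP => i j; rewrite (ord1 j) mul_diag_mx !mxE mulrC divzK //.
    rewrite -eqz_mod_dvd; have : val (f x i) = val (f y i) by rewrite fxy.
    rewrite !ffunE /=.
    by move/(congr1 Posz); rewrite !gez0_abs ?modz_ge0 // => ->.
  apply/ffunP => i; rewrite !ffunE; apply: val_inj => /=; congr absz.
  apply/eqP; rewrite eqz_mod_dvd; have := xy i 0.
  by rewrite mul_diag_mx !mxE => <-; rewrite dvdz_mulr.
Qed.

(** Smith normal form writes M as P D Q with D diagonal and P, Q unimodular. Q maps Z^d onto itself
    and P is an automorphism of Z^d, so the index is that of D; the determinants of P and Q are
    units of Z. *)
Lemma mulmx_index (d : nat) (M : 'M[int]_d) :
  \det M != 0 -> has_index [set: 'cV[int]_d] (mulmx M @` setT) `|\det M|.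
Proof.
have [P Pu [Q Qu [s _ ->]]] := int_Smith_normal_form M.
pose e : 'rV[int]_d := \row_i s`_i.
have -> : \matrix_(i, j) (s`_i *+ (i == j)) = diag_mx e.
  by apply/matrixP => i j; rewrite !mxE.
rewrite !det_mulmx !mulf_eq0 !negb_or => /andP[/andP[_ De] _].
have abs1 (A : 'M[int]_d) : A \in unitmx -> `|\det A|%N = 1%N.
  by rewrite unitmxE => /orP[] /eqP ->.
rewrite !abszM (abs1 P) // (abs1 Q) // mul1n muln1; move: De; rewrite det_diag => De.
have e0 i : e 0 i != 0 by move/prodf_neq0: De; apply.
have surj (A : 'M[int]_d) : A \in unitmx -> mulmx A @` [set: 'cV_d] = setT.
  move=> Au; apply/seteqP; split=> // x _; exists (invmx A *m x) => //.
  by rewrite mulKVmx.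
have -> : mulmx (P *m diag_mx e *m Q) @` setT =
          mulmx P @` (mulmx (diag_mx e) @` [set: 'cV_d]).
  rewrite -{2}(surj _ Qu) !image_comp; congr (_ @` _).
  by apply/funext => x /=; rewrite !mulmxA.
rewrite -{1}(surj _ Pu).
exact: (@has_index_inj _ _ (mulmx P) _ _ _ (can_inj (mulKmx Pu)) (diag_mx_index e0)).
Qed.

(** * Isometries, images of lattices and lattice endomorphisms *)

Lemma image_setI_inj (T U : Type) (f : T -> U) (X Y : set T) :
  injective f -> f @` (X `&` Y) = f @` X `&` f @` Y.
Proof.
move=> f_inj; apply/seteqP; split; first exact: sub_image_setI.
by move=> _ [[x Xx <-] [y Yy /f_inj yx]]; exists x => //; split=> //; rewrite -yx.
Qed.

Lemma is_isometry_mulmxT (R : realType) (d : nat) (A : 'M[R]_d) :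
  is_isometry A -> A *m A^T = 1%:M.
Proof. exact: mulmx1C. Qed.

Lemma is_isometryT (R : realType) (d : nat) (A : 'M[R]_d) :
  is_isometry A -> is_isometry A^T.
Proof. by move=> hA; rewrite /is_isometry trmxK is_isometry_mulmxT. Qed.

Lemma is_isometryM (R : realType) (d : nat) (A A' : 'M[R]_d) :
  is_isometry A -> is_isometry A' -> is_isometry (A *m A').
Proof.
move=> hA hA'; rewrite /is_isometry trmx_mul mulmxA -(mulmxA A'^T) hA.
by rewrite mulmx1.
Qed.

Lemma is_isometry_inj (R : realType) (d : nat) (A : 'M[R]_d) :
  is_isometry A -> injective (mulmx A : 'cV[R]_d -> 'cV[R]_d).
Proof. by move=> hA; apply: (can_inj (g := mulmx A^T)) => x; rewrite mulmxA hA mul1mx. Qed.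

Lemma is_isometry_det (R : realType) (d : nat) (A : 'M[R]_d) :
  is_isometry A -> `|\det A| = 1.
Proof.
move=> /(congr1 determinant); rewrite det_mulmx det_tr det1 => /(congr1 Num.norm).
by rewrite normrM normr1 -expr2 => /eqP; rewrite sqrp_eq1 // => /eqP.
Qed.

Lemma image_lattice_mul (R : realType) (d : nat) (A A' : 'M[R]_d) (L : set 'cV[R]_d) :
  image_lattice A (image_lattice A' L) = image_lattice (A *m A') L.
Proof.
rewrite /image_lattice image_comp; congr (_ @` _).
by apply/funext => x; rewrite /= mulmxA.
Qed.

Lemma image_lattice1 (R : realType) (d : nat) (L : set 'cV[R]_d) :
  image_lattice 1%:M L = L.
Proof.
by apply/seteqP; split=> [_ [x Lx <-]|x Lx]; [rewrite mul1mx|exists x; rewrite ?mul1mx].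
Qed.

Lemma is_lattice_subgroup (R : realType) (d : nat) (L : set 'cV[R]_d) :
  is_lattice L -> is_subgroup L.
Proof.
move=> [B _ ->].
apply: (@is_subgroup_image _ _ (mulmx B \o map_mx intr)); exact: is_subgroupT.
Qed.

Lemma image_lattice_subgroup (R : realType) (d : nat) (A : 'M[R]_d) (L : set 'cV[R]_d) :
  is_subgroup L -> is_subgroup (image_lattice A L).
Proof. exact: (@is_subgroup_image _ _ (mulmx A)). Qed.

(** Column j of [N] holds the integer coordinates, in the basis [B], of the image under [C] of the
    j-th basis vector. *)
Lemma lattice_endo_matrix (R : realType) (d : nat) (B C : 'M[R]_d) :
  (let L := [set B *m map_mx intr z | z in [set: 'cV[int]_d]] in
   image_lattice C L `<=` L) ->
  exists N : 'M[int]_d, C *m B = B *m map_mx intr N.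
Proof.
move=> /= CL.
have [j|z zP] := @boolp.choice 'I_d 'cV[int]_d
    (fun j z => C *m col j B = B *m map_mx intr z).
  have [|z _ zE] := CL (C *m col j B); last by exists z.
  exists (col j B) => //; exists (delta_mx j 0) => //.
  by rewrite map_delta_mx colE.
exists (\matrix_(i, j) z j i 0); apply/matrixP => i j.
have /matrixP/(_ i 0) := zP j.
rewrite !mxE (eq_bigr (fun a => C i a * B a j)) => [->|a _]; last by rewrite mxE.
by apply: eq_bigr => a _; rewrite !mxE.
Qed.

(** In a basis of [L], the map [C] becomes an integer matrix similar to [C], hence with the same
    determinant, and the index is computed in Z^d. *)
Lemma lattice_endo_index (R : realType) (d : nat) (L : set 'cV[R]_d)
    (C : 'M[R]_d) (n : nat) :
  is_lattice L -> image_lattice C L `<=` L -> (0 < n)%N -> `|\det C| = n%:R ->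
  has_index L (image_lattice C L) n.
Proof.
move=> [B Bu LE] CL n0 detC.
have [|N CB] := @lattice_endo_matrix _ _ B C; first by rewrite /= -LE.
have detN : (\det N)%:~R = \det C.
  apply: (mulfI (x := \det B)); first by rewrite -unitfE -unitmxE.
  by rewrite -det_map_mx -det_mulmx -CB det_mulmx mulrC.
have absN : `|\det N|%N = n.
  by apply/eqP; rewrite -(eqr_nat R) natr_absz intr_norm detN detC.
have N0 : \det N != 0 by rewrite -absz_gt0 absN.
pose phi : {additive 'cV[int]_d -> 'cV[R]_d} := mulmx B \o map_mx intr.
have phi_inj : injective phi.
  move=> x y /(can_inj (mulKmx Bu)) /matrixP xy; apply/matrixP => i j.
  by have /eqP := xy i j; rewrite !mxE eqr_int => /eqP.
have := has_index_inj phi_inj (mulmx_index N0); rewrite absN.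
have -> : phi @` setT = L by rewrite LE.
have -> // : phi @` (mulmx N @` setT) = image_lattice C L.
rewrite LE /image_lattice !image_comp; congr (_ @` _).
by apply/funext => z; rewrite /phi /= map_mxM !mulmxA CB.
Qed.

(** * Coincidence indices of inverses and products *)

(** Merges finiteness and value of the index into one condition, so that each index computation also
    proves that the isometry is a coincidence isometry. *)
Definition coincidence_of_index (R : realType) (d : nat) (L : set 'cV[R]_d)
    (k : nat) (A : 'M[R]_d) : Prop :=
  is_isometry A /\ has_index L (coincidence_lattice L A) k.

Lemma coincidence_lattice_subgroup (R : realType) (d : nat) (L : set 'cV[R]_d) (A : 'M[R]_d) :
  is_subgroup L -> is_subgroup (coincidence_lattice L A).
Proof. by move=> sL; apply: is_subgroupI => //; exact: image_lattice_subgroup. Qed.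

(** By Lagrange, kL lies in L ∩ AL and so in AL; now apply A^T. This integrality serves both the
    index of the inverse and the finiteness argument. *)
Lemma coincidence_of_index_scale (R : realType) (d : nat) (L : set 'cV[R]_d)
    (A : 'M[R]_d) (k : nat) :
  is_subgroup L -> coincidence_of_index L k A ->
  image_lattice (k%:R *: A^T) L `<=` L.
Proof.
move=> sL [hA Ak] _ [x Lx <-].
have sK := coincidence_lattice_subgroup A sL.
have [_ [y Ly yE]] := has_index_Lagrange sL sK (@subIsetl _ _ _) Ak Lx.
by rewrite -scalemxAl scalemxAr scaler_nat -yE mulmxA hA mul1mx.
Qed.

Lemma coincidence_of_indexT (R : realType) (d : nat) (L : set 'cV[R]_d)
    (A : 'M[R]_d) (k : nat) :
  is_lattice L -> coincidence_of_index L k A -> coincidence_of_index L k A^T.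
Proof.
move=> hL hAk; have [hA Ak] := hAk.
have sL := is_lattice_subgroup hL.
have sK := coincidence_lattice_subgroup A sL.
have k0 := has_index_gt0 sL Ak.
have kd0 : (0 < k ^ d)%N by rewrite expn_gt0 k0.
pose Z := image_lattice (k%:R%:M) L.
have ZK : Z `<=` coincidence_lattice L A.
  move=> _ [x Lx <-]; rewrite mul_scalar_mx scaler_nat.
  exact: has_index_Lagrange sL sK (@subIsetl _ _ _) Ak Lx.
have ZL : Z `<=` L by move=> x /ZK[].
have sZ : is_subgroup Z by exact: image_lattice_subgroup.
have sAL : is_subgroup (image_lattice A L) by exact: image_lattice_subgroup.
have LZ : has_index L Z (k ^ d).
  by apply: lattice_endo_index => //; rewrite det_scalar -natrX normr_nat.
have ALZ : has_index (image_lattice A L) Z (k ^ d).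
  (* Pulling back by A reduces the index of kL in AL to that of k A^T L in L, where the determinant
     of k A^T has absolute value k^d. *)
  have -> : Z = image_lattice A (image_lattice (k%:R *: A^T) L).
    by rewrite image_lattice_mul -scalemxAr is_isometry_mulmxT // scalemx1.
  apply: (@has_index_inj _ _ (mulmx A)); first exact: is_isometry_inj.
  apply: lattice_endo_index => //; first exact: coincidence_of_index_scale.
  by rewrite detZ det_tr normrM is_isometry_det // mulr1 -natrX normr_nat.
(* With Z = kL, both [L : Z] and [AL : Z] are k^d, so K = L :&: AL has the same
   index in L and in AL. *)
have [a [b [La Kb ab]]] := has_index_tower sL sK sZ ZK (@subIsetl _ _ _) LZ.
have [c [e [Ac Ke ce]]] := has_index_tower sAL sK sZ ZK (@subIsetr _ _ _) ALZ.
have ck : c = k.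
  move: ce; rewrite (has_index_uniq Ke Kb) -ab (has_index_uniq La Ak) => /eqP.
  by rewrite eqn_pmul2r ?(has_index_gt0 sK Kb) // => /eqP.
split; first exact: is_isometryT.
(* A^T carries the pair AL, L ∩ AL to the pair L, L ∩ A^T L. *)
have := has_index_inj (phi := mulmx A^T) (is_isometry_inj (is_isometryT hA)) Ac.
have -> : mulmx A^T @` image_lattice A L = L.
  by rewrite [LHS]image_lattice_mul hA image_lattice1.
have -> : mulmx A^T @` coincidence_lattice L A = coincidence_lattice L A^T.
  rewrite image_setI_inj; last exact: is_isometry_inj (is_isometryT hA).
  by rewrite [X in _ `&` X]image_lattice_mul hA image_lattice1 setIC.
by rewrite ck.
Qed.

(** Put M = AL and N = AA'L. Applying A gives [M : M ∩ N] = n, so the index of L ∩ M ∩ N in L ∩ M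
    divides n, and its index in L divides mn. The group L ∩ N lies between L ∩ M ∩ N and L. *)
Lemma coincidence_of_index_mul_dvd (R : realType) (d : nat) (L : set 'cV[R]_d)
    (A A' : 'M[R]_d) (m n : nat) :
  is_subgroup L -> coincidence_of_index L m A -> coincidence_of_index L n A' ->
  exists2 k, (k %| m * n)%N & coincidence_of_index L k (A *m A').
Proof.
move=> sL [hA Am] [hA' An].
pose M := image_lattice A L; pose N := image_lattice (A *m A') L.
have sM : is_subgroup M by exact: image_lattice_subgroup.
have sN : is_subgroup N by exact: image_lattice_subgroup.
have MN : has_index M (M `&` N) n.
  have := has_index_inj (phi := mulmx A) (is_isometry_inj hA) An.
  rewrite image_setI_inj; last exact: is_isometry_inj.
  by rewrite [X in _ `&` X]image_lattice_mul.
have sLM : is_subgroup (L `&` M) by exact: is_subgroupI.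
have sMN : is_subgroup (M `&` N) by exact: is_subgroupI.
have sLN : is_subgroup (L `&` N) by exact: is_subgroupI.
have sI : is_subgroup (L `&` M `&` (M `&` N)) by exact: is_subgroupI.
have [n' n'n LMN] :=
  has_index_dvd_setI sM sLM sMN (@subIsetl _ _ _) (@subIsetr _ _ _) MN.
have LI := has_index_mul sL (@subIsetl _ _ _) sLM (@subIsetl _ _ _) Am LMN.
have sub : L `&` M `&` (M `&` N) `<=` L `&` N by move=> x [[? _] [_ ?]].
have [a [b [La _ ab]]] := has_index_tower sL sLN sI sub (@subIsetl _ _ _) LI.
exists a; last by split=> //; exact: is_isometryM.
apply: (dvdn_trans (dvdn_mulr b (dvdnn a))).
by rewrite ab dvdn_mul.
Qed.

Lemma coincidence_of_index_mul (R : realType) (d : nat) (L : set 'cV[R]_d)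
    (A A' : 'M[R]_d) (m n : nat) :
  is_lattice L -> coprime m n ->
  coincidence_of_index L m A -> coincidence_of_index L n A' ->
  coincidence_of_index L (m * n) (A *m A').
Proof.
move=> hL mn Am An; have sL := is_lattice_subgroup hL.
have [k kmn Ak] := coincidence_of_index_mul_dvd sL Am An.
(* m = Sigma(A A' A'^T) divides k n, and n = Sigma(A^T A A') divides m k. *)
suff -> : (m * n)%N = k by [].
apply/eqP; rewrite eqn_dvd kmn andbT Gauss_dvd //; apply/andP; split.
  have [m' + [_ Am']] :=
    coincidence_of_index_mul_dvd sL Ak (coincidence_of_indexT hL An).
  rewrite -mulmxA is_isometry_mulmxT ?mulmx1 in Am' *; last exact: An.1.
  by rewrite (has_index_uniq Am' Am.2) Gauss_dvdl.
have [n' + [_ An']] :=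
  coincidence_of_index_mul_dvd sL (coincidence_of_indexT hL Am) Ak.
rewrite mulmxA Am.1 mul1mx in An' *.
by rewrite (has_index_uniq An' An.2) Gauss_dvdr // coprime_sym.
Qed.

(** For index 1, Lagrange with exponent 1 gives L ⊆ AL; the same inclusion for A^T, which also has
    index 1, gives AL ⊆ L. *)
Lemma point_groupP (R : realType) (d : nat) (L : set 'cV[R]_d) (A : 'M[R]_d) :
  is_lattice L -> point_group L A <-> coincidence_of_index L 1 A.
Proof.
move=> hL; have sL := is_lattice_subgroup hL.
have sub C : coincidence_of_index L 1 C -> L `<=` image_lattice C L.
  move=> [_ C1] x Lx.
  have sK := coincidence_lattice_subgroup C sL.
  by have [] := has_index_Lagrange sL sK (@subIsetl _ _ _) C1 Lx.
split=> [[hA AL]|A1].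
  split=> //; rewrite /coincidence_lattice AL setIid.
  exists unit, (fun=> tt); split=> [|[]|x y Lx Ly]; rewrite ?card_unit //.
    by exists 0 => //; exact: sL.1.
  by split=> // _; exact: sL.2.
split; first exact: A1.1.
apply/seteqP; split; last exact: sub.
have /(image_subset (mulmx A)) := sub _ (coincidence_of_indexT hL A1).
by rewrite [X in _ `<=` X]image_lattice_mul is_isometry_mulmxT ?image_lattice1 //; exact: A1.1.
Qed.

(** * Finiteness of the set of coincidence isometries of a given index *)

Lemma is_isometry_le1 (R : realType) (d : nat) (A : 'M[R]_d) i j :
  is_isometry A -> `|A i j| <= 1.
Proof.
move=> /matrixP/(_ j j); rewrite !mxE eqxx mulr1n => E.
rewrite -(ler_pXn2r (n := 2)) ?nnegrE // expr1n real_normK ?num_real // -E.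
rewrite (bigD1 i) //= mxE -expr2 lerDl sumr_ge0 // => a _.
by rewrite mxE -expr2 sqr_ge0.
Qed.

Lemma finite_bounded_int_mx (d b : nat) :
  finite_set [set N : 'M[int]_d | forall i j, `|N i j| <= b%:Z].
Proof.
(* The interval [-b, b] has 2b + 1 integers; shifting by b moves it to the ordinals. *)
pose g (X : 'M['I_(b.*2.+1)]_d) : 'M[int]_d := \matrix_(i, j) ((X i j)%:Z - b%:Z).
apply: (@sub_finite_set _ _ (g @` setT)); last exact/finite_image/finite_finset.
move=> N Nb; exists (\matrix_(i, j) inord `|N i j + b%:Z|) => //.
apply/matrixP => i j; rewrite !mxE inordK.
  have := Nb i j; rewrite ler_norml => /andP[lb _].
  by rewrite gez0_abs ?addrK // -lerBlDr sub0r.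
have := Nb i j; rewrite ler_norml => /andP[lb ub].
rewrite ltnS -lez_nat gez0_abs -?lerBlDr ?sub0r //.
by rewrite -addnn PoszD lerD2r.
Qed.

Lemma finite_coincidence_of_index (R : realType) (d : nat) (L : set 'cV[R]_d) (k : nat) :
  is_lattice L -> finite_set (coincidence_of_index L k).
Proof.
move=> hL; have [k0|k0] := posnP k.
  rewrite (_ : coincidence_of_index L k = set0) // -subset0 => A [_ Ak].
  by have := has_index_gt0 (is_lattice_subgroup hL) Ak; rewrite k0.
(* In a basis of L, k A^T is an integer matrix; its entries are bounded because
   those of an isometry are. *)
have [B Bu LE] := hL.
(* The inner sums bound entry (i, j) of B^-1 (k A^T) B by the triangle inequality, as entries of A
   are at most 1 in absolute value; summing over i and j makes the bound uniform. [F] recovers A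
   from that integer matrix. *)
pose beta := \sum_i \sum_j \sum_a \sum_c `|invmx B i a| * k%:R * `|B c j|.
pose b := Num.bound beta.
pose F (N : 'M[int]_d) := (k%:R^-1 *: (B *m map_mx intr N *m invmx B))^T : 'M[R]_d.
apply: (@sub_finite_set _ _ (F @` [set N : 'M[int]_d | forall i j, `|N i j| <= b%:Z])).
  move=> A Ak.
  have [|N NE] := @lattice_endo_matrix _ _ B (k%:R *: A^T).
    by rewrite /= -LE; exact: coincidence_of_index_scale (is_lattice_subgroup hL) Ak.
  exists N; last first.
    rewrite /F -NE mulmxK // scalerA mulVf ?pnatr_eq0 -?lt0n // scale1r.
    by rewrite trmxK.
  move=> i j; rewrite -(ler_int R) intr_norm.
  have -> : (N i j)%:~R = (invmx B *m (k%:R *: A^T *m B)) i j :> R.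
    by rewrite NE mulKmx // mxE.
  have h0 i' j' a c : 0 <= `|invmx B i' a| * k%:R * `|B c j'|.
    by rewrite !mulr_ge0.
  have beta0 : 0 <= beta by do 4! apply: sumr_ge0 => ? _; exact: h0.
  apply: (le_trans _ (ltW (archi_boundP beta0))).
  rewrite /beta (bigD1 i) //= (bigD1 j) //= -addrA ler_wpDr //.
    by rewrite addr_ge0 //; do ?[apply: sumr_ge0 => ? _]; exact: h0.
  rewrite mxE (le_trans (ler_norm_sum _ _ _)) // ler_sum // => a _.
  rewrite mxE mulr_sumr (le_trans (ler_norm_sum _ _ _)) // ler_sum // => c _.
  rewrite !mxE !normrM mulrA ler_wpM2r // ler_wpM2l // normr_nat.
  by rewrite ler_piMr // is_isometry_le1 //; exact: Ak.1.
exact/finite_image/finite_bounded_int_mx.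
Qed.

(** * Counting pairs of coincidence isometries *)

Lemma card_set_le_inj (T U : choiceType) (f : T -> U) (X : set T) (Y : set U) :
  finite_set X -> finite_set Y -> (forall x, X x -> Y (f x)) ->
  {in X &, injective f} -> (card_set X <= card_set Y)%N.
Proof.
move=> finX finY fXY f_inj.
have <- : #|` f @` fset_set X|%fset = card_set X.
  by apply: card_in_imfset => x y; rewrite /= !in_fset_set //; exact: f_inj.
apply: fsubset_leq_card; apply/fsubsetP => _ /imfsetP[x /= + ->].
by rewrite !in_fset_set // !inE; exact: fXY.
Qed.

Lemma card_setX (T U : choiceType) (X : set T) (Y : set U) :
  finite_set X -> finite_set Y ->
  card_set (X `*` Y) = (card_set X * card_set Y)%N.
Proof.
move=> finX finY; rewrite /card_set fset_setX // -(size_allpairs pair).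
apply: perm_size; apply: uniq_perm.
- exact: fset_uniq.
- by apply: allpairs_uniq => [||[? ?] [? ?]]; rewrite ?fset_uniq.
- move=> [x y]; rewrite in_fsetM; apply/andP/allpairsP => [[Xx Yy]|[[? ?] [? ? [-> ->]]]//].
  by exists (x, y).
Qed.

(** The inequality with denominators cleared. The bound on fibres takes the form of one injection
    from pairs of isometries into pairs of a point group element and a product. *)
Lemma card_coincidence_mul (R : realType) (d : nat) (L : set 'cV[R]_d) (m n : nat) :
  is_lattice L -> coprime m n ->
  (card_set (coincidence_of_index L m) * card_set (coincidence_of_index L n) <=
   card_set (coincidence_of_index L 1) * card_set (coincidence_of_index L (m * n)))%N.
Proof.
move=> hL mn; have sL := is_lattice_subgroup hL.
have fin k := finite_coincidence_of_index k hL.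
(* [r] chooses a first factor of each product Q, and (A, A') is recovered from
   Q = A A' together with the point group element (r Q)^T A. *)
pose good (Q A : 'M[R]_d) :=
  coincidence_of_index L m A /\ coincidence_of_index L n (A^T *m Q).
pose r Q := xget 0 (good Q).
have rP A A' : coincidence_of_index L m A -> coincidence_of_index L n A' ->
    good (A *m A') (r (A *m A')).
  move=> Am An; apply: xgetPex; exists A; split=> //.
  by rewrite mulmxA Am.1 mul1mx.
rewrite -!card_setX //.
apply: (@card_set_le_inj _ _ (fun p => ((r (p.1 *m p.2))^T *m p.1, p.1 *m p.2))).
- exact: finite_setX.
- exact: finite_setX.
- move=> [A A'] [/= Am An]; split=> /=; last exact: coincidence_of_index_mul.
  have [rm rn] := rP _ _ Am An; set Q := A *m A' in rm rn *.
  have [k km Tk] := coincidence_of_index_mul_dvd sL (coincidence_of_indexT hL rm) Am.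
  have [l ln Tl] := coincidence_of_index_mul_dvd sL rn (coincidence_of_indexT hL An).
  (* Two factorizations of the same element: the left one shows that its index divides n^2, the
     right one that it divides m^2. *)
  have TE : (r Q)^T *m Q *m A'^T = (r Q)^T *m A.
    by rewrite -!mulmxA is_isometry_mulmxT ?mulmx1 //; exact: An.1.
  rewrite TE in Tl; have kl := has_index_uniq Tk.2 Tl.2.
  suff /eqP <- : k == 1%N by [].
  rewrite -dvdn1 -(eqP (_ : coprime (m * m) (n * n))) ?dvdn_gcd ?km ?kl ?ln //.
  by rewrite coprimeMl !coprimeMr mn.
- move=> [A A'] [C C']; rewrite !inE => -[/= Am An] [/= Cm Cn] [TE QE].
  have [rm _] := rP _ _ Am An.
  (* The choice [r] depends only on the product, which the two pairs share, so the isometry r (A A')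
     cancels. *)
  have AC : A = C.
    move: TE; rewrite -QE => /(congr1 (mulmx (r (A *m A')))).
    by rewrite !mulmxA is_isometry_mulmxT ?mul1mx //; exact: rm.1.
  by rewrite AC in QE *; congr pair; move/(congr1 (mulmx C^T)): QE; rewrite !mulmxA Cm.1 !mul1mx.
Qed.

Theorem theorem4 (R : realType) (d : nat) (L : set 'cV[R]_d)
    (hL : is_lattice L) (m n : nat) (hm : (0 < m)%N) (hn : (0 < n)%N)
    (hmn : coprime m n) :
  fiso L m * fiso L n <= fiso L (m * n)%N.
Proof.
have sL := is_lattice_subgroup hL.
have SE k : [set A | coincidence_isometries L A /\ coincidence_index L A = k] =
    coincidence_of_index L k.
  apply/seteqP; split=> A.
    by move=> [[hA fA] iA]; split=> //; apply/has_indexP => //; exact: coincidence_lattice_subgroup.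
  move=> [hA /has_indexP[]//]; exact: coincidence_lattice_subgroup.
have PE : point_group L = coincidence_of_index L 1.
  by apply/seteqP; split=> A /point_groupP; apply.
rewrite /fiso !SE PE.
set p := card_set (coincidence_of_index L 1).
(* For p = 0 both sides vanish, as the inverse of 0 is 0 in [rat]. *)
have [->|p0] := posnP p; first by rewrite invr0 !mulr0.
rewrite mulf_div ler_pdivrMr ?mulr_gt0 ?ltr0n // [_ * (p%:R * p%:R)]mulrA.
rewrite mulfVK ?pnatr_eq0 -?lt0n // mulrC -!natrM ler_nat.
by rewrite mulnC [leqRHS]mulnC; exact: card_coincidence_mul.
Qed.
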